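(* Let $(u_1, u_2, u_3)$ be a Büchi triple. Then there exist non-negative integers $s_1, s_3, s_4, s_6$ and $\beta \in \{1,2\}$ satisfying $s_1 s_3 - s_4 s_6 = \beta$, such that \[u_1 = \frac{s_1 s_3 - s_3 s_4 + s_1 s_6 + s_4 s_6}{\beta}, \quad u_2 = \frac{s_3 s_4 + s_1 s_6}{\beta}, \quad u_3 = \frac{s_1 s_3 + s_3 s_4 - s_1 s_6 + s_4 s_6}{\beta}.\]
   Context: A Büchi $n$-tuple is an $n$-tuple $(u_1, \dots, u_n)$ of positive integers such that $u_1^2, \dots, u_n^2$ is an increasing sequence of squares with second difference equal to $2$, i.e. $u_{k+2}^2 - 2u_{k+1}^2 + u_k^2 = 2$ for $1 \le k \le n-2$. A Büchi triple is a Büchi $3$-tuple. *)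

(* Defs.v *)
From mathcomp Require Import all_boot all_order all_algebra.
Set Implicit Arguments.
Unset Strict Implicit.
Unset Printing Implicit Defensive.
Import Order.TTheory GRing.Theory Num.Theory.
Local Open Scope ring_scope.

(* Indices are 0-based: the entry u_(k+1) of the Buchi tuple is u`_k. *)
Definition buchi_tuple (n : nat) (u : n.-tuple int) : Prop :=
  [/\ forall k : nat, (k < n)%N -> 0 < u`_k,
      forall k : nat, (k.+1 < n)%N -> u`_k ^+ 2 < u`_k.+1 ^+ 2
    & forall k : nat, (k.+2 < n)%N ->
        u`_k.+2 ^+ 2 - 2 * u`_k.+1 ^+ 2 + u`_k ^+ 2 = 2].

Definition buchi_triple (u1 u2 u3 : int) : Prop :=
  buchi_tuple [tuple u1; u2; u3].

(* Main.v *)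
Require Import Defs.
From mathcomp Require Import all_boot all_order all_algebra.
From mathcomp Require Import ring zify.
Set Implicit Arguments.
Unset Strict Implicit.
Unset Printing Implicit Defensive.
Import Order.TTheory GRing.Theory Num.Theory.
Local Open Scope ring_scope.

(** Since [u1] and [u3] have the same parity, [x = (u1 + u3) / 2] and
    [y = (u3 - u1) / 2] are integers, and the Buechi condition becomes
    [(x + 1) (x - 1) = (u2 + y) (u2 - y)]. Euler's four number theorem splits
    this as [x + 1 = s1 s3], [x - 1 = s4 s6], [u2 + y = s3 s4],
    [u2 - y = s1 s6], so that [beta = 2] always works. *)

(** Take [s3 = gcdz a c], [s1 = a / s3], [s4 = c / s3]. Cancelling [s3] gives [s1 * b = s4 * d] with
    [s1], [s4] coprime, so [s1] divides [d], and [s6] is the quotient. *)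
Lemma four_numbers (a b c d : int) :
    0 < a -> 0 <= c -> 0 <= d -> a * b = c * d ->
  exists s1 s3 s4 s6 : int,
    [/\ 0 <= s1, 0 <= s3, 0 <= s4 & 0 <= s6] /\
    [/\ a = s1 * s3, b = s4 * s6, c = s3 * s4 & d = s1 * s6].
Proof.
move=> a0 c0 d0 abcd.
have g0 : 0 < gcdz a c by rewrite lt0r gcdz_eq0 negb_and gt_eqF.
have /dvdzP[s1 ea] := dvdz_gcdl a c.
have /dvdzP[s4 ec] := dvdz_gcdr a c.
have s1_gt0 : 0 < s1 by rewrite -(pmulr_lgt0 _ g0) -ea.
have s4_ge0 : 0 <= s4 by rewrite -(pmulr_lge0 _ g0) -ec.
have s1bE : s1 * b = s4 * d.
  apply: (mulIf (lt0r_neq0 g0)).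
  by rewrite mulrAC -ea [RHS]mulrAC -ec.
have cop : coprimez s1 s4.
  apply/eqP/(mulIf (lt0r_neq0 g0)); rewrite mul1r.
  have -> : gcdz s1 s4 * gcdz a c = gcdz (s1 * gcdz a c) (s4 * gcdz a c).
    by rewrite -mulz_gcdl gtz0_abs.
  by rewrite -ea -ec.
have /dvdzP[s6 ed] : (s1 %| d)%Z.
  by rewrite -(Gauss_dvdzr d cop) -s1bE dvdz_mulr.
have s6_ge0 : 0 <= s6 by rewrite -(pmulr_lge0 _ s1_gt0) -ed.
exists s1, (gcdz a c), s4, s6; split; first by split=> //; exact: ltW.
split=> //; rewrite 1?mulrC //.
apply: (mulfI (lt0r_neq0 s1_gt0)); rewrite s1bE ed; ring.
Qed.

Theorem theorem1p5 (u1 u2 u3 : int) (hu : buchi_triple u1 u2 u3) :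
  exists s1 s3 s4 s6 beta : int,
    [/\ 0 <= s1, 0 <= s3, 0 <= s4 & 0 <= s6] /\
    (beta = 1 \/ beta = 2) /\
    s1 * s3 - s4 * s6 = beta /\
    [/\ u1%:Q = (s1 * s3 - s3 * s4 + s1 * s6 + s4 * s6)%:Q / beta%:Q,
        u2%:Q = (s3 * s4 + s1 * s6)%:Q / beta%:Q
      & u3%:Q = (s1 * s3 + s3 * s4 - s1 * s6 + s4 * s6)%:Q / beta%:Q].
Proof.
case: hu => pos inc diff2.
have u1_gt0 : 0 < u1 := pos 0%N isT.
have u2_gt0 : 0 < u2 := pos 1%N isT.
have u3_gt0 : 0 < u3 := pos 2%N isT.
have u12 : u1 ^+ 2 < u2 ^+ 2 := inc 0%N isT.
have u23 : u2 ^+ 2 < u3 ^+ 2 := inc 1%N isT.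
have u123 : u3 ^+ 2 - 2 * u2 ^+ 2 + u1 ^+ 2 = 2 := diff2 0%N isT.
have u13 : u1 < u3.
  by rewrite -(ltr_pXn2r (n := 2)) ?nnegrE ?ltW // (lt_trans u12).
have [y u3E] : exists y, u3 = u1 + 2 * y.
  exists ((u3 - u1) %/ 2)%Z.
  have := divz_eq (u3 - u1) 2.
  have := @modz_ge0 (u3 - u1) 2 isT.
  have := @ltz_pmod (u3 - u1) 2 isT.
  move: ((u3 - u1) %/ 2)%Z ((u3 - u1) %% 2)%Z => q r r_lt2 r_ge0 qr.
  have [r0|r1] : r = 0 \/ r = 1 by lia.
    by lia.
  (* An odd difference makes [u1 ^+ 2 + u3 ^+ 2] odd, yet it equals [2 * u2 ^+ 2 + 2]. *)
  exfalso; have u3q : u3 = u1 + (q * 2 + 1) by lia.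
  by move: u123; rewrite u3q; nia.
have y_gt0 : 0 < y by lia.
have prodE : (u1 + y + 1) * (u1 + y - 1) = (u2 + y) * (u2 - y).
  by move: u123; rewrite u3E; nia.
(* The left side of [prodE] is nonnegative since [u1] and [y] are at least 1, and the cofactor
   [u2 + y] is positive. *)
have u2y : 0 <= u2 - y.
  rewrite -(pmulr_rge0 _ (addr_gt0 u2_gt0 y_gt0)) -prodE.
  by apply: mulr_ge0; lia.
have [|||s1 [s3 [s4 [s6 [s_ge0 [e1 e2 e3 e4]]]]]] := four_numbers _ _ _ prodE.
- by lia.
- by lia.
- by [].
(* With [x = u1 + y], beta is [(x + 1) - (x - 1) = 2], and the three numerators are [2 * (x - y)],
   [2 * u2] and [2 * (x + y)]. *)
exists s1, s3, s4, s6, 2; split=> //; split; first by right.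
rewrite -e1 -e2 -e3 -e4; split; first by ring.
have halfE (m n : int) : n = m * 2 -> m%:Q = n%:Q / 2%:Q.
  by move=> ->; rewrite intrM mulfK.
by split; apply: halfE; rewrite ?u3E; ring.
Qed.
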